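(* Let $G$ be a loopless graph. Then the following are equivalent: (a) the closed-neighbourhood-set system $(V(G),\mathcal{N}_{cl}(G))$ is a well-graded family; (b) the closed-neighbourhood-set system $(V(G),\mathcal{N}_{cl}(G))$ is an extremal system; (c) $G$ is either a complete graph or a between-full-union of some co-half-graphs and a complete graph; (d) the neighbourhood-set system $(V(G^c),\mathcal{N}(G^c))$ of the complement $G^c$ is a well-graded family. Moreover, the following are equivalent: $(V(G),\mathcal{N}_{cl}(G))$ is a maximum system; $(V(G^c),\mathcal{N}(G^c))$ is a maximum system; $G$ is a complete graph.
   Context: Graphs are finite, undirected, with nonempty vertex set (in particular complete graphs have at least one vertex) and no multiple edges. $N_G(v)$ is the set of vertices adjacent to $v$, $N_G[v]=N_G(v)\cup\{v\}$, $\mathcal{N}(G)=\{N_G(v):v\in V(G)\}$, $\mathcal{N}_{cl}(G)=\{N_G[v]:v\in V(G)\}$ (sets of subsets of $V(G)$, without multiplicities). For a loopless graph $G$, the complement $G^c$ is the loopless graph on the same vertex set in which two distinct vertices are adjacent iff they are not adjacent in $G$. A co-half-graph of order $n\ge1$ is a graph with vertices $a_1,\dots,a_n,b_1,\dots,b_n$ whose edges are exactly: $a_ia_j$ and $b_ib_j$ for all $i\ne j$, and $a_ib_j$ for all $i>j$. The between-full-union of graphs $G_1$ and $G_2$ is the graph on the disjoint union of $V(G_1)$ and $V(G_2)$ with edge set $E(G_1)\cup E(G_2)\cup\{(v,w):v\in V(G_1),w\in V(G_2)\}$; it is applied iteratively to several graphs. A set system $(X,\mathcal{F})$ is a finite set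 $X$ with a nonempty family $\mathcal{F}$ of distinct subsets of $X$. Its one-inclusion graph has a vertex $v_A$ for each $A\in\mathcal{F}$, with an edge (directed from $v_A$ to $v_B$, labelled $b$) whenever $B=A\cup\{b\}$ for some $b\in X\setminus A$. The system is well-graded if for all $A,B\in\mathcal{F}$ the distance between $v_A$ and $v_B$ in the underlying undirected graph equals $|A\triangle B|$ (infinite distance if there is no path). $Y\subseteq X$ is shattered if $\mathcal{F}\cap Y:=\{A\cap Y:A\in\mathcal{F}\}$ is the full power set of $Y$; the VC-dimension is the largest size of a shattered set. $Y$ is strongly shattered if there is $T\subseteq X\setminus Y$ with $\{Z\cup T:Z\subseteq Y\}\subseteq\mathcal{F}$. The system is extremal if the shattered and strongly shattered sets coincide. The system, with VC-dimension $d$, is maximum if $|\mathcal{F}\cap Y|=\sum_{i=0}^d\binom{|Y|}{i}$ for every $Y\subseteq X$. *)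

(* Defs.v *)
From mathcomp Require Import all_boot.

Set Implicit Arguments.
Unset Strict Implicit.
Unset Printing Implicit Defensive.

(* Finite undirected graphs without multiple edges; loops are allowed. *)
Record graph := Graph {
  vertex :> finType;
  adj : rel vertex;
  adj_sym : symmetric adj;
  vertex_gt0 : 0 < #|vertex|
}.

Definition loopless (G : graph) : Prop := irreflexive (@adj G).

Definition nbhd (G : graph) (v : G) : {set G} := [set u | adj v u].

Definition cl_nbhd (G : graph) (v : G) : {set G} := v |: nbhd v.

Definition nbhd_family (G : graph) : {set {set G}} := [set nbhd v | v : G].

Definition cl_nbhd_family (G : graph) : {set {set G}} := [set cl_nbhd v | v : G].

Definition isomorphic (G H : graph) : Prop :=
  exists2 f : G -> H, bijective f & forall u v, adj (f u) (f v) = adj u v.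

Definition compl_adj (G : graph) : rel G :=
  fun u v => (u != v) && ~~ adj u v.

Lemma compl_adj_sym (G : graph) : symmetric (@compl_adj G).
Proof. by move=> u v; rewrite /compl_adj eq_sym adj_sym. Qed.

Definition compl (G : graph) : graph :=
  Graph (@compl_adj_sym G) (vertex_gt0 G).

Definition complete (G : graph) : Prop := forall u v : G, adj u v = (u != v).

(* [inl i] is a_i and [inr i] is b_i. *)
Definition co_half_adj (n : nat) : rel ('I_n + 'I_n) := fun u v =>
  match u, v with
  | inl i, inl j => i != j
  | inr i, inr j => i != j
  | inl i, inr j => j < i
  | inr j, inl i => j < i
  end.

Lemma co_half_adj_sym (n : nat) : symmetric (@co_half_adj n).
Proof. by case=> i [] j //=; rewrite eq_sym. Qed.

Lemma co_half_gt0 (n : nat) : 0 < #|{: 'I_n.+1 + 'I_n.+1}|.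
Proof. by rewrite card_sum card_ord. Qed.

(* The co-half-graph of order n.+1, so that every order is at least 1. *)
Definition co_half_graph (n : nat) : graph :=
  Graph (@co_half_adj_sym n.+1) (co_half_gt0 n).

Definition full_union_adj (G H : graph) : rel (G + H) := fun u v =>
  match u, v with
  | inl x, inl y => adj x y
  | inr x, inr y => adj x y
  | _, _ => true
  end.

Lemma full_union_adj_sym (G H : graph) : symmetric (@full_union_adj G H).
Proof. by case=> x [] y //=; rewrite adj_sym. Qed.

Lemma full_union_gt0 (G H : graph) : 0 < #|{: G + H}|.
Proof. by rewrite card_sum addn_gt0 vertex_gt0. Qed.

Definition full_union (G H : graph) : graph :=
  Graph (@full_union_adj_sym G H) (full_union_gt0 G H).

(* A set system (X, F) is given by F alone, X being the whole type. Families *)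
(* of (closed) neighbourhoods are nonempty because vertex types are.           *)
(* The edge from A to B labelled b in the one-inclusion graph. *)
Definition inclusion_edge (X : finType) (F : {set {set X}})
    (b : X) (A B : {set X}) : bool :=
  [&& A \in F, B \in F, b \notin A & B == b |: A].

Definition one_inclusion (X : finType) (F : {set {set X}}) : rel {set X} :=
  fun A B => [exists b, inclusion_edge F b A B || inclusion_edge F b B A].

Definition shattered (X : finType) (F : {set {set X}}) (Y : {set X}) :
    bool :=
  [set A :&: Y | A in F] == powerset Y.

Definition strongly_shattered (X : finType) (F : {set {set X}}) (Y : {set X}) :
    bool :=
  [exists T : {set X},
    (T \subset ~: Y) && ([set Z :|: T | Z in powerset Y] \subset F)].

Definition vc_dim (X : finType) (F : {set {set X}}) : nat := \max_(Y : {set X} | shattered F Y) #|Y|.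

Definition extremal (X : finType) (F : {set {set X}}) : Prop :=
  forall Y, shattered F Y = strongly_shattered F Y.

Definition maximum (X : finType) (F : {set {set X}}) : Prop :=
  forall Y : {set X},
    #|[set A :&: Y | A in F]| = \sum_(0 <= i < (vc_dim F).+1) 'C(#|Y|, i).

(* The distance from x to y in the graph e is finite and equal to n. *)
Definition at_distance (T : eqType) (e : rel T) (x y : T) (n : nat) : Prop :=
  (exists p, [/\ path e x p, last x p = y & size p = n]) /\
  (forall p, path e x p -> last x p = y -> n <= size p).

Definition well_graded (X : finType) (F : {set {set X}}) : Prop :=
  forall A B : {set X}, A \in F -> B \in F ->
    at_distance (one_inclusion F) A B #|(A :\: B) :|: (B :\: A)|.

(* Main.v *)
Require Import Defs.
From mathcomp Require Import all_boot zify.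

(* Write H for the complement of G. Closed neighbourhoods of G are complements
   of neighbourhoods of H, and complementing all members preserves all the
   properties at stake. A family is well-graded iff from any member one can
   always move one step towards any other. If N(w) = N(v) + b in H, then N(b) is
   the only neighbourhood distinguishing v from w, so N(b) has at most two
   neighbours in the one-inclusion graph. Hence, for well-graded N(H), the empty
   set is a neighbourhood and any two neighbourhoods are nested or disjoint: H is
   a disjoint union of half-graphs and isolated vertices, that is, G is as in (c).
   Conversely in such an H every nonempty neighbourhood A has a point x with
   A - x a neighbourhood and A the least neighbourhood containing x; this gives
   extremality and well-gradedness. A maximum system of VC-dimension at least 1
   has more members than points, so N(G) being maximum forces dimension 0. *)

Set Implicit Arguments.
Unset Strict Implicit.
Unset Printing Implicit Defensive.

(** * Set systems *)

(** Symmetric difference with a singleton: flipping is an involution and treats adding and removing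
    a point alike. *)
Definition flip (X : finType) (x : X) (A : {set X}) : {set X} :=
  [set y | (y \in A) != (y == x)].

(** Local form of well-gradedness: the flipped point separates [A] from [B], so the move brings [A]
    one nearer to [B]. *)
Definition step (X : finType) (F : {set {set X}}) : Prop :=
  forall A B : {set X}, A \in F -> B \in F -> A != B ->
  exists2 x, (x \in A) != (x \in B) & flip x A \in F.

Definition compl_family (X : finType) (F : {set {set X}}) : {set {set X}} :=
  [set ~: A | A in F].

Section SetSystems.

Variable X : finType.
Implicit Types (F : {set {set X}}) (A B C Y Z T : {set X}).

Lemma in_flip x A y : (y \in flip x A) = ((y \in A) != (y == x)).
Proof. by rewrite inE. Qed.

Lemma flip_inv x A B : flip x A = B -> A = flip x B.
Proof.
move=> <-; apply/setP=> y; rewrite !in_flip.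
by case: (y \in A); case: (y == x).
Qed.

Lemma flipC x A : flip x (~: A) = ~: flip x A.
Proof.
apply/setP=> y; rewrite !inE.
by case: (y \in A); case: (y == x).
Qed.

Lemma one_inclusionP F A B :
  reflect [/\ A \in F, B \in F & exists x, B = flip x A] (one_inclusion F A B).
Proof.
apply: (iffP existsP) => [[x /orP[]] /and4P[FA FB xA /eqP defB]|].
- split=> //; exists x; rewrite defB; apply/setP=> y; rewrite !inE.
  by have [->|_] := eqVneq y x; rewrite ?(negPf xA) //=; case: (y \in A).
- split=> //; exists x; rewrite defB; apply/setP=> y; rewrite !inE.
  by have [->|_] := eqVneq y x; rewrite ?(negPf xA) //=; case: (y \in B).
case=> FA FB [x defB]; exists x; rewrite /inclusion_edge FA FB /=.
rewrite defB !in_flip eqxx; case xA: (x \in A); rewrite /= ?orbF;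
  apply/eqP/setP=> y.
  by rewrite !inE; have [->|] := eqVneq y x; rewrite ?xA //; case: (y \in A).
by rewrite !inE; have [->|] := eqVneq y x; rewrite ?xA //; case: (y \in A).
Qed.

Lemma path_symdiff F A p : path (one_inclusion F) A p ->
  #|A :\: last A p :|: last A p :\: A| <= size p.
Proof.
elim: p A => [|B p IHp] A /=; first by rewrite setDv setUid cards0.
case/andP=> /one_inclusionP[_ _ [x defB]] /IHp; rewrite -ltnS.
apply: leq_trans; set C := last B p; set E := B :\: C :|: C :\: B.
have /subset_leq_card : A :\: C :|: C :\: A \subset x |: E.
  apply/subsetP=> y; rewrite !inE defB in_flip.
  by case: (y == x) => //; case: (y \in A); case: (y \in C).
by move/leq_trans; apply; rewrite cardsU1; case: (x \in E).
Qed.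

Lemma well_graded_step F : well_graded F <-> step F.
Proof.
split=> [wgF A B FA FB neqAB | stF A B FA FB].
  have [[[|C p] [pathp lastp sizep]] _] := wgF A B FA FB.
    by case/eqP: neqAB.
  have {pathp} /= /andP[/one_inclusionP[_ FC [x defC]] pathp] := pathp.
  exists x; last by rewrite -defC.
  (* If the first edge of a geodesic did not approach [B], its tail would be shorter than the
     symmetric difference of [C] and [B]. *)
  apply: contraT; rewrite negbK => /eqP xAB.
  have [_ /(_ p pathp lastp)] := wgF C B FC FB.
  rewrite leqNgt => /negP[]; rewrite -[(size p).+1]/(size (C :: p)) sizep.
  apply: subset_leq_card; apply/subsetP=> y; rewrite !inE defC in_flip.
  have [->|_] := eqVneq y x; first by rewrite xAB andNb.
  by case: (y \in A); case: (y \in B).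
split; last by move=> p pathp <-; apply: path_symdiff pathp.
have [n] := ubnP #|A :\: B :|: B :\: A|; elim: n A FA => // n IHn A FA.
have [-> _|neqAB] := eqVneq A B.
  by exists [::]; split; rewrite ?setDv ?setUid ?cards0.
rewrite ltnS => lt_n; have [x xAB Fx] := stF A B FA FB neqAB.
have defD : A :\: B :|: B :\: A = x |: (flip x A :\: B :|: B :\: flip x A).
  apply/setP=> y; rewrite !inE; have [->|_] := eqVneq y x.
    by move: xAB; case: (x \in A); case: (x \in B).
  by case: (y \in A); case: (y \in B).
have nx : x \notin flip x A :\: B :|: B :\: flip x A.
  by rewrite !inE eqxx; move: xAB; case: (x \in A); case: (x \in B).
move: lt_n; rewrite defD cardsU1 nx => lt_n.
have [p [pathp lastp sizep]] := IHn _ Fx lt_n.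
exists (flip x A :: p); split=> //=; last by rewrite sizep.
by rewrite pathp andbT; apply/one_inclusionP; split=> //; exists x.
Qed.

(** Walking from [A] to [B] step by step, [x] has to be removed at some moment, and that move is an
    edge labelled [x]. *)
Lemma step_label F A B x : step F ->
    A \in F -> B \in F -> x \in A -> x \notin B ->
  exists2 C, C \in F & (x \notin C) && (flip x C \in F).
Proof.
move=> stF; have [n] := ubnP #|A :\: B :|: B :\: A|.
elim: n A => // n IHn A leAB FA FB xA xB.
have [|y yAB FAy] := stF A B FA FB.
  by apply: contraNneq xB => <-.
have [eqyx|neqyx] := eqVneq y x.
  exists (flip y A) => //; rewrite eqyx in FAy *.
  by rewrite in_flip xA eqxx -(flip_inv (erefl _)).
apply: (IHn (flip y A)) => //;
  last by rewrite in_flip xA (eq_sym x) (negPf neqyx).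
rewrite ltnS in leAB; apply: leq_trans leAB; apply: proper_card.
apply/properP; split.
  apply/subsetP=> z; rewrite !inE; have [->|_] := eqVneq z y.
    by move: yAB; case: (y \in A); case: (y \in B).
  by case: (z \in A); case: (z \in B).
by exists y; move: yAB; rewrite !inE ?eqxx; case: (y \in A); case: (y \in B).
Qed.

(** * Shattering and extremal systems *)

Lemma shatteredP F Y :
  reflect (forall Z, Z \subset Y -> exists2 A, A \in F & A :&: Y = Z)
          (shattered F Y).
Proof.
apply: (iffP eqP) => [defP Z sZY | shF].
  have : Z \in powerset Y by rewrite inE.
  by rewrite -defP => /imsetP[A FA ->]; exists A.
apply/setP=> Z; rewrite inE; apply/imsetP/idP=> [[A _ ->]|/shF[A FA <-]].
  exact: subsetIr.
by exists A.
Qed.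

Lemma strongly_shatteredP F Y :
  reflect (exists2 T : {set X}, [disjoint T & Y] &
             forall Z, Z \subset Y -> Z :|: T \in F)
          (strongly_shattered F Y).
Proof.
apply: (iffP existsP) => [[T /andP[sTY /subsetP ssF]] | [T dTY ssF]].
  exists T; rewrite ?disjoints_subset // => Z sZY.
  by apply: ssF; apply/imsetP; exists Z; rewrite // inE.
exists T; rewrite -disjoints_subset dTY; apply/subsetP=> W /imsetP[Z + ->].
by rewrite inE; apply: ssF.
Qed.

Lemma strongly_shattered_shattered F Y :
  strongly_shattered F Y -> shattered F Y.
Proof.
case/strongly_shatteredP=> T dTY ssF; apply/shatteredP=> Z sZY.
exists (Z :|: T); first exact: ssF.
by rewrite setIUl (setIidPl sZY) (disjoint_setI0 dTY) setU0.
Qed.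

Lemma extremalP F :
  extremal F <-> forall Y, shattered F Y -> strongly_shattered F Y.
Proof.
split=> [extF Y|extF Y]; first by rewrite extF.
by apply/idP/idP; [apply: extF | apply: strongly_shattered_shattered].
Qed.

Lemma shatteredS F F' Y : F \subset F' -> shattered F Y -> shattered F' Y.
Proof.
move/subsetP=> sFF' /shatteredP shF; apply/shatteredP=> Z /shF[A FA <-].
by exists A; rewrite ?sFF'.
Qed.

(** Strong shattering in [F] gives a cube over [Y] on one side of [x]. If it is the wrong side, this
    cube and the traces of the half together shatter [x |: Y]; the larger cube that results then has
    a face on the right side. *)
Lemma extremal_half F x c :
  extremal F -> extremal [set C in F | (x \in C) == c].
Proof.
move/extremalP=> extF; apply/extremalP=> Y; set H := [set C in F | _] => shY.
have sHF : H \subset F by apply/subsetP=> C; rewrite inE => /andP[].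
have /shatteredP traceH := shY.
have xY : x \notin Y.
  apply/negP=> xY; have [|A] := traceH (if c then set0 else [set x]).
  - by case: (c); rewrite ?sub0set ?sub1set.
  rewrite inE => /andP[_ /eqP xA] /setP/(_ x); rewrite inE xY xA.
  by case: (c); rewrite inE ?eqxx.
have /extF/strongly_shatteredP[T dTY ssT] := shatteredS sHF shY.
have [xT|xT] := eqVneq (x \in T) c.
  apply/strongly_shatteredP; exists T => // Z sZY; rewrite inE ssT // inE xT.
  have /negPf-> : x \notin Z by apply: contraNN xY; apply: subsetP.
  by rewrite /= eqxx.
have : shattered F (x |: Y).
  apply/shatteredP=> W sW.
  have sWY : W :\ x \subset Y by rewrite subDset.
  have splitW A : (x \in A) = (x \in W) -> A :&: Y = W :\ x ->
      A :&: (x |: Y) = W.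
    move=> xAW /setP defA; apply/setP=> y; move: (defA y); rewrite !inE.
    have [->|_] := eqVneq y x; first by rewrite andbT.
    by move=> ->.
  have [xW|xW] := eqVneq (x \in W) c.
    have [A /[!inE] /andP[FA /eqP xA] defA] := traceH _ sWY.
    by exists A; rewrite // splitW // xA xW.
  exists ((W :\ x) :|: T); first exact: ssT.
  apply: splitW; last first.
    by rewrite setIUl (setIidPl sWY) (disjoint_setI0 dTY) setU0.
  by move: xW xT; rewrite !inE eqxx /=; case: (x \in W); case: (x \in T);
    case: c {H sHF shY traceH}.
case/extF/strongly_shatteredP=> U dU ssU.
have xU : x \notin U by rewrite (disjointFl dU) // setU11.
apply/strongly_shatteredP; exists (if c then x |: U else U) => [|Z sZY].
  have dUY : [disjoint U & Y] by apply: disjointWr dU; apply: subsetUr.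
  case: (c) => //; rewrite disjoints_subset subUset sub1set inE xY.
  by rewrite -disjoints_subset.
have xZ : x \notin Z by apply: contraNN xY; apply: subsetP.
rewrite inE; case: (c).
  by rewrite setUCA setUA ssU ?setUS //= !inE eqxx.
rewrite ssU; last exact: subset_trans sZY (subsetUr _ _).
by rewrite inE (negPf xZ) (negPf xU).
Qed.

Lemma extremal_subcube F A (s : seq X) :
  extremal F -> extremal [set C in F | all (fun x => (x \in C) == (x \in A)) s].
Proof.
move=> extF; elim: s => [|x s IHs].
  rewrite (_ : [set C in F | _] = F) //.
  by apply/setP=> C; rewrite inE andbT.
set E := [set C in F | _]; suff -> : E = [set C in
    [set C in F | all (fun x => (x \in C) == (x \in A)) s]
    | (x \in C) == (x \in A)] by apply: extremal_half.
by apply/setP=> C; rewrite !inE /=; rewrite [X in _ && X]andbC andbA.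
Qed.

(* Among the members of F between A and B, one nearest to A differs from A in a
   single point: otherwise the subcube spanned by the two would contain only
   those two, and shatter a point without strongly shattering it. *)
Lemma extremal_step F : extremal F -> step F.
Proof.
move=> extF A B FA; have [n] := ubnP #|A :\: B :|: B :\: A|.
elim: n B => // n IHn B leAB FB neqAB.
have [/existsP[C /and4P[FC nCA nCB /subsetP sC]]|/existsPn noC] :=
  boolP [exists C, [&& C \in F, C != A, C != B &
    A :\: C :|: C :\: A \subset A :\: B :|: B :\: A]].
  have ltAC : #|A :\: C :|: C :\: A| < n.
    rewrite ltnS in leAB; apply: leq_trans leAB; apply: proper_card.
    rewrite properEneq; apply/andP; split; last exact/subsetP.
    apply: contraNN nCB => /eqP/setP eqD; apply/eqP/setP=> y.
    have := eqD y; rewrite !inE.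
    by case: (y \in A); case: (y \in C); case: (y \in B).
  rewrite eq_sym in nCA; have [x xAC Fx] := IHn C ltAC FC nCA.
  exists x => //; have := sC x; rewrite !inE; move: xAC.
  by case: (x \in A); case: (x \in C); case: (x \in B) => //= _ ->.
set D := A :\: B :|: B :\: A in noC.
set E := [set C in F | all (fun x => (x \in C) == (x \in A)) (enum (~: D))].
have inE_ C : C \in E -> C = A \/ C = B.
  rewrite inE => /andP[FC /allP CA]; have := noC C; rewrite FC /=.
  have [->|_] := eqVneq C A; first by left.
  have [->|_] := eqVneq C B; first by right.
  case/subsetPn=> y yCA yD; have := CA y; rewrite mem_enum inE yD.
  by move/(_ isT)/eqP=> yC; move: yCA; rewrite !inE yC andNb.
have EA : A \in E by rewrite inE FA; apply/allP=> x.
have EB : B \in E.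
  rewrite inE FB; apply/allP=> x; rewrite mem_enum !inE.
  by case: (x \in A); case: (x \in B).
have [x xAB] : exists x, (x \in A) != (x \in B).
  apply/existsP; apply: contraNT neqAB => /existsPn eqAB.
  by apply/eqP/setP=> x; have := eqAB x; rewrite negbK => /eqP.
have : shattered E [set x].
  apply/shatteredP=> Z; rewrite subset1 => defZ.
  exists (if (x \in A) == (x \in Z) then A else B); first by case: ifP.
  apply/setP=> y; rewrite !inE; have [->|neq] := eqVneq y x; last first.
    by rewrite andbF; case/orP: defZ => /eqP->; rewrite !inE ?(negPf neq).
  rewrite andbT; move: xAB.
  by case: ifP; case: (x \in Z); case: (x \in A); case: (x \in B).
have /extremalP extE := extremal_subcube A (enum (~: D)) extF.
case/extE/strongly_shatteredP=> T; rewrite disjoint_sym disjoints1 => xT ssT.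
(* The two ends of this one-dimensional cube can only be [A] and [B], in some order. *)
have {ssT} [ET ETx] : T \in E /\ x |: T \in E.
  by split; [rewrite -(set0U T) ssT ?sub0set | rewrite ssT].
have FlT : flip x T = x |: T.
  by apply/setP=> y; rewrite !inE; have [->|] := eqVneq y x;
    rewrite ?(negPf xT) //=; case: (y \in T).
exists x => //.
have neqT : T <> x |: T by move=> eqT; move: xT; rewrite eqT setU11.
have sEF C : C \in E -> C \in F by rewrite inE => /andP[].
case: (inE_ _ ET) => defT; first by rewrite -defT FlT sEF.
case: (inE_ _ ETx) => defTx; last by case: neqT; rewrite defTx.
by rewrite -defTx -(flip_inv FlT) sEF.
Qed.

(** * Complementing all members of a family *)

Lemma compl_familyK F : compl_family (compl_family F) = F.
Proof.
rewrite /compl_family -imset_comp -[RHS]imset_id; apply: eq_imset => A /=.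
exact: setCK.
Qed.

Lemma mem_compl_family F A : (A \in compl_family F) = (~: A \in F).
Proof.
apply/imsetP/idP=> [[B FB ->]|FA]; first by rewrite setCK.
by exists (~: A); rewrite ?setCK.
Qed.

Lemma step_compl F : step F -> step (compl_family F).
Proof.
move=> stF A B; rewrite !mem_compl_family => FA FB neqAB.
have [|x xAB Fx] := stF _ _ FA FB; first by rewrite (inj_eq (@setC_inj _)).
exists x; last by rewrite mem_compl_family -flipC.
by move: xAB; rewrite !inE; case: (x \in A); case: (x \in B).
Qed.

Lemma setCI_trace A Y : ~: A :&: Y = Y :\: (A :&: Y).
Proof. by rewrite setDIr setDv setU0 setDE setIC. Qed.

(** On [Y] the traces of the complements are the relative complements of the traces, and [Y :\: _]
    is injective on subsets of [Y]. *)
Lemma card_trace_compl F Y :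
  #|[set A :&: Y | A in compl_family F]| = #|[set A :&: Y | A in F]|.
Proof.
rewrite -imset_comp (eq_imset (g := (fun B => Y :\: B) \o (fun A => A :&: Y)));
  last by move=> A /=; rewrite setCI_trace.
rewrite imset_comp; apply: card_in_imset => _ _ /imsetP[A _ ->] /imsetP[B _ ->].
move/(congr1 (fun C => Y :\: C)); rewrite !setDDr !setDv !set0U.
by rewrite !(setIC Y) -!setIA !setIid.
Qed.

Lemma shattered_compl F Y : shattered (compl_family F) Y = shattered F Y.
Proof.
have sP (F' : {set {set X}}) : [set A :&: Y | A in F'] \subset powerset Y.
  by apply/subsetP=> _ /imsetP[A _ ->]; rewrite inE subsetIr.
by rewrite /shattered !eqEcard !sP card_trace_compl.
Qed.

Lemma extremal_compl F : extremal F -> extremal (compl_family F).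
Proof.
move/extremalP=> extF; apply/extremalP=> Y; rewrite shattered_compl.
case/extF/strongly_shatteredP=> T dTY ssT; apply/strongly_shatteredP.
(* Complementing the cube over [Y] with base [T] gives the cube over [Y] with this base. *)
exists (~: (T :|: Y)).
  by rewrite disjoint_sym disjoints_subset setCK subsetUr.
move=> Z sZY; rewrite mem_compl_family.
suff -> : ~: (Z :|: ~: (T :|: Y)) = (Y :\: Z) :|: T by rewrite ssT ?subsetDl.
apply/setP=> y; rewrite !inE negb_or negbK.
have /implyP := subsetP sZY y; have := @disjointFr _ _ _ y dTY.
by case: (y \in T) => [->|_] //; case: (y \in Z); case: (y \in Y).
Qed.

Lemma maximum_compl F : maximum F -> maximum (compl_family F).
Proof.
move=> maxF Y; rewrite card_trace_compl maxF; congr (\sum_(0 <= i < _.+1) _).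
by apply: eq_bigl => Z; rewrite shattered_compl.
Qed.

Lemma maximum_card1 (A : {set X}) : maximum [set A].
Proof.
move=> Y; rewrite imset_set1 cards1.
suff -> : vc_dim [set A] = 0 by rewrite big_nat1 bin0.
apply/eqP; rewrite -leqn0; apply/bigmax_leqP=> Z /eqP.
rewrite imset_set1 => /(congr1 (fun P : {set {set X}} => #|P|)).
rewrite cards1 card_powerset => /eqP.
by rewrite -{1}(expn0 2) eqn_exp2l // => /eqP <-.
Qed.

(** On the whole ground set the binomial sum begins with 1 + |X| once the dimension is positive. *)
Lemma small_maximum F : maximum F -> #|F| <= #|X| -> #|F| = 1.
Proof.
move/(_ setT) => cardF leFX; move: cardF.
rewrite (_ : [set _ | _ in _] = F); last first.
  by rewrite -[RHS]imset_id; apply: eq_imset => A; rewrite setIT.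
rewrite cardsT big_nat_recl // bin0; case: (vc_dim F) => [|d].
  by rewrite big_geq.
rewrite big_nat_recl // bin1 => cardF.
by move: leFX; rewrite cardF add1n ltnNge leq_addr.
Qed.

(** With [A :\ x] as the parent of [A], the members form a tree rooted at the empty set. *)
Definition tree_like F : Prop :=
  set0 \in F /\ forall A, A \in F -> A != set0 -> exists x,
    [/\ x \in A, A :\ x \in F & forall B, B \in F -> x \in B -> A \subset B].

Lemma flipD1 x A : x \in A -> flip x A = A :\ x.
Proof.
move=> xA; apply/setP=> y; rewrite !inE.
by have [->|] := eqVneq y x; rewrite ?xA //; case: (y \in A).
Qed.

(** If [A] is not inside [B], peel the point of [A]: it is not in [B]. Otherwise a smallest member
    [C] strictly above [A] and inside [B] loses its point to become [A], by minimality. *)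
Lemma tree_like_step F : tree_like F -> step F.
Proof.
case=> F0 treeF A B FA FB neqAB.
have [sAB|nsAB] := boolP (A \subset B); last first.
  have [|x [xA FAx minx]] := treeF A FA.
    by apply: contraNneq nsAB => ->; rewrite sub0set.
  exists x; last by rewrite flipD1.
  by rewrite xA; apply: contraNneq nsAB => xB; apply: minx.
have exC : exists C, [&& C \in F, A \proper C & C \subset B].
  by exists B; rewrite FB properEneq neqAB sAB /=.
have [C /and3P[FC pAC sCB] minC] :=
  @arg_minnP _ (xchoose exC) _ (fun C => #|C|) (xchooseP exC).
have [sAC nsCA] : A \subset C /\ ~~ (C \subset A) by apply/andP.
have [|x [xC FCx minx]] := treeF C FC.
  by apply: contraNneq nsCA => ->; rewrite sub0set.
have xA : x \notin A by apply: contraNN nsCA; apply: minx.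
have sACx : A \subset C :\ x by rewrite subsetD1 sAC.
have defA : A = C :\ x.
  apply/eqP; apply: contraT => neqACx.
  have := minC (C :\ x); rewrite FCx properEneq neqACx sACx /=.
  rewrite (subset_trans (subsetDl _ _) sCB) => /(_ isT).
  by rewrite (cardsD1 x C) xC ltnn.
exists x; first by rewrite (negPf xA) (subsetP sCB).
by rewrite defA -flipD1 // -(flip_inv (erefl _)).
Qed.

(** A shattered set has at most one point: given two, the point [x] peeled from a smallest member
    containing both is one of them, and every member through [x] contains both. For one point, a
    smallest member through it and its parent form the cube. *)
Lemma tree_like_extremal F : tree_like F -> extremal F.
Proof.
case=> F0 treeF; apply/extremalP=> Y /shatteredP shY.
(* In a smallest member satisfying [P], peeling the point destroys [P]. *)
have descend (P : pred {set X}) : ~~ P set0 -> (exists2 A, A \in F & P A) ->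
    exists A x, [/\ A \in F, P A, x \in A & A :\ x \in F /\ ~~ P (A :\ x)] /\
      forall B, B \in F -> x \in B -> A \subset B.
  move=> nP0 [A0 FA0 PA0].
  have PA0' : (A0 \in F) && P A0 by rewrite FA0.
  have [A /andP[FA PA] minA] :=
    @arg_minnP _ A0 (fun A => (A \in F) && P A) (fun A => #|A|) PA0'.
  have [|x [xA FAx minx]] := treeF A FA.
    by apply: contraNneq nP0 => <-.
  exists A, x; split=> //; split=> //; split=> //.
  apply/negP=> PAx; have := minA (A :\ x); rewrite FAx PAx => /(_ isT).
  by rewrite (cardsD1 x A) xA ltnn.
have trace Z : Z \subset Y ->
    exists2 A, A \in F & forall y, y \in Y -> (y \in A) = (y \in Z).
  case/shY=> A FA defA; exists A => // z zY.
  by rewrite -defA inE zY andbT.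
have [->|[y yY]] := set_0Vmem Y.
  apply/strongly_shatteredP; exists set0; first by rewrite -setI_eq0 setI0.
  by move=> Z; rewrite subset0 => /eqP->; rewrite setU0.
have defY : Y = [set y].
  apply/eqP; rewrite eqEsubset sub1set yY andbT.
  apply/subsetP=> z zY; rewrite inE; apply: contraT => neqzy.
  have [A FA inA] := trace Y (subxx _).
  have [||C [x [[FC /andP[yC zC] xC [_ nCx]] minx]]] :=
    descend (fun A => (y \in A) && (z \in A)).
  - by rewrite !inE.
  - by exists A; rewrite // !inA // yY.
  have [B FB inB] : exists2 B, B \in F &
      forall w, w \in Y -> (w \in B) = (w == x).
    have [|B FB inB] := trace ([set x] :&: Y) _; first exact: subsetIr.
    by exists B => // w wY; rewrite inB // !inE wY andbT.
  have xyz : (x == y) || (x == z).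
    by move: nCx; rewrite !inE yC zC !andbT negb_and !negbK !(eq_sym x).
  have xY : x \in Y by case/orP: xyz => /eqP->.
  have /subsetP sCB : C \subset B by apply: minx; rewrite // inB.
  have := sCB y yC; have := sCB z zC; rewrite !inB //.
  by move=> /eqP zx /eqP yx; rewrite zx yx eqxx in neqzy.
have [A FA inA] := trace Y (subxx _).
have [||C [x [[FC yC xC [FCx nCx]] minx]]] := descend (fun A => y \in A).
- by rewrite inE.
- by exists A; rewrite // inA.
have {minx} defx : x = y.
  by apply/eqP; move: nCx; rewrite !inE yC andbT negbK eq_sym.
rewrite defY; apply/strongly_shatteredP; exists (C :\ y).
  by rewrite disjoint_sym disjoints1 setD11.
move=> Z; rewrite subset1 => /orP[]/eqP->.
  by rewrite setD1K.
by rewrite set0U -{1}defx.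
Qed.

End SetSystems.

(** * Half-graph decomposition *)

(* The property [tree_like] of the neighbourhoods of [e], stated pointwise and
   without an isolated vertex so that it passes to disjoint unions. *)
Definition peelable (T : eqType) (e : rel T) : Prop :=
  forall u z, e u z -> exists x, [/\ e u x,
    forall v, e v x -> forall y, e u y -> e v y &
    (forall y, e u y = (y == x)) \/
    exists u', forall y, e u' y = e u y && (y != x)].

Definition isolated (T : Type) (e : rel T) (z : T) : Prop :=
  forall y, ~~ e z y.

(** The complement is a half-graph; the comparison is reflexive because a_i and b_i are not adjacent
    in the co-half-graph. *)
Lemma compl_co_half_adj n (u v : co_half_graph n) :
  compl_adj u v = match u, v with
    | inl i, inr j | inr j, inl i => i <= j
    | _, _ => false
    end.
Proof.
by case: u v => i [] j; rewrite /compl_adj /= -?leqNgt //; exact: andbN.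
Qed.

(** In the complement, N(a_i) consists of the b_j with j at least i, and N(b_i) of the a_j with j at
    most i. Peeling b_i, respectively a_i, leaves N(a_(i+1)), respectively N(b_(i-1)), or nothing at
    the end of the order. *)
Lemma peelable_co_half n : peelable (@compl_adj (co_half_graph n)).
Proof.
have adjE := @compl_co_half_adj n.
case=> i z _.
  exists (inr i); split.
  - by rewrite !adjE.
  - case=> k; rewrite !adjE // => leki [] j; rewrite adjE // => leij.
    rewrite adjE; exact: leq_trans leij.
  have [ltin|leni] := ltnP i n; [right | left].
    exists (inl (Ordinal (ltin : i.+1 < n.+1))) => -[] j; rewrite !adjE //=.
    by rewrite ltn_neqAle andbC eq_sym.
  move=> [] j; first by rewrite !adjE.
  rewrite !adjE; apply/idP/eqP => [leij|[->] //].
  by congr (inr _); apply: val_inj => /=; have := ltn_ord j; lia.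
exists (inl i); split.
- by rewrite !adjE.
- case=> k; rewrite !adjE // => leki [] j; rewrite adjE // => leji.
  rewrite adjE; exact: leq_trans leji leki.
have [i0|i_gt0] := posnP i; [left | right].
  move=> [] j; last by rewrite !adjE.
  rewrite !adjE; apply/idP/eqP => [leij|[->] //].
  by congr (inl _); apply: val_inj => /=; lia.
have lti := ltn_ord i.
have ltp : i.-1 < n.+1 by lia.
exists (inr (Ordinal ltp)) => -[] j; rewrite !adjE //=.
by rewrite -ltnS prednK // ltn_neqAle andbC.
Qed.

(** The complement of a between-full-union is the disjoint union of the complements, so
    neighbourhoods stay on one side. *)
Lemma peelable_full_union (G H : graph) :
  peelable (@compl_adj G) -> peelable (@compl_adj H) ->
  peelable (@compl_adj (full_union G H)).
Proof.
move=> pG pH [] u [] z //.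
  case/(pG u z)=> x [ux minx peelx]; exists (inl x); split=> //.
    by case=> // v /minx sub [] // y; apply: sub.
  case: peelx => [defu|[u' defu']]; [left | right].
    by case=> // y; apply: defu.
  by exists (inl u') => -[] // y; apply: defu'.
case/(pH u z)=> x [ux minx peelx]; exists (inr x); split=> //.
  by case=> // v /minx sub [] // y; apply: sub.
case: peelx => [defu|[u' defu']]; [left | right].
  by case=> // y; apply: defu.
by exists (inr u') => -[] // y; apply: defu'.
Qed.

Lemma complete_isolated (K : graph) (z : K) : complete K ->
  isolated (@compl_adj K) z.
Proof. by move=> cK y; rewrite /compl_adj cK andbN. Qed.

Lemma complete_peelable (K : graph) : complete K -> peelable (@compl_adj K).
Proof. by move=> cK u z; rewrite /compl_adj cK andbN. Qed.

Lemma full_unions_peelable (K : graph) (ns : seq nat) : complete K ->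
  let G := foldr full_union K (map co_half_graph ns) in
  peelable (@compl_adj G) /\ exists z, isolated (@compl_adj G) z.
Proof.
move=> cK /=; elim: ns => [|n ns [IHp [z IHz]]] /=.
  split; first exact: complete_peelable.
  have /card_gt0P[z _] := vertex_gt0 K.
  by exists z; apply: complete_isolated.
split; first exact: peelable_full_union (@peelable_co_half n) IHp.
by exists (inr z) => -[] // y; apply: IHz.
Qed.

Lemma compl_adj_iso (G H : graph) (f : G -> H) : injective f ->
  (forall u v, adj (f u) (f v) = adj u v) ->
  forall u v, compl_adj (f u) (f v) = compl_adj u v.
Proof. by move=> fI fM u v; rewrite /compl_adj fM (inj_eq fI). Qed.

Lemma peelable_iso (G H : graph) : isomorphic G H ->
    peelable (@compl_adj H) -> (exists z, isolated (@compl_adj H) z) ->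
  peelable (@compl_adj G) /\ exists z, isolated (@compl_adj G) z.
Proof.
case=> f [g fK gK] fM pH [z zI].
have cM := compl_adj_iso (can_inj fK) fM; split; last first.
  by exists (g z) => y; rewrite -cM gK.
have cMr u y : compl_adj u (g y) = compl_adj (f u) y by rewrite -cM gK.
move=> u w; rewrite -cM => /pH[x [ux minx peelx]]; exists (g x); split.
- by rewrite cMr.
- by move=> v; rewrite cMr => /minx sub y; rewrite -!cM; apply: sub.
case: peelx => [defu|[u' defu']]; [left | right].
  by move=> y; rewrite -cM defu (can2_eq fK gK).
by exists (g u') => y; rewrite -cM gK defu' cM (can2_eq fK gK).
Qed.

Lemma card_ord_lt m k : k <= m -> #|[set j : 'I_m | j < k]| = k.
Proof.
move=> lekm; rewrite -sum1_card (eq_bigl (fun j : 'I_m => j < k)).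
  by rewrite -(big_ord_widen m (fun=> 1) lekm) sum_nat_const card_ord muln1.
by move=> j; rewrite inE.
Qed.

(** An initial segment is determined by its size; this will turn degrees into adjacencies. *)
Lemma down_closed_ord m (D : {set 'I_m}) :
    (forall i j : 'I_m, i <= j -> j \in D -> i \in D) ->
  forall i : 'I_m, (i \in D) = (i < #|D|).
Proof.
move=> downD i; apply/idP/idP=> [Di|].
  rewrite -(card_ord_lt (ltn_ord i)); apply: subset_leq_card.
  by apply/subsetP=> j; rewrite inE ltnS => /downD; apply.
apply: contraLR => nDi; rewrite -leqNgt -[X in _ <= X](card_ord_lt (ltnW
  (ltn_ord i))).
apply: subset_leq_card; apply/subsetP=> j Dj; rewrite inE ltnNge.
by apply: contra nDi => leij; apply: downD Dj.
Qed.

(** Pigeonhole for values from 1 to m, to be applied to degrees; values are lowered by one to land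
    in an ordinal type. *)
Lemma card_inj_range (T : finType) (A : {set T}) (f : T -> nat) m :
    {in A &, injective f} -> {in A, forall x, 0 < f x <= m} ->
  #|A| <= m /\ (m <= #|A| -> forall k, 0 < k <= m ->
    exists2 x, x \in A & f x = k).
Proof.
move=> fI fm; case: m fm => [|m] fm.
  split=> [|_ k]; last by lia.
  rewrite leqn0 cards_eq0; apply/eqP/setP=> x; rewrite !inE.
  by apply/negP=> /fm; lia.
pose h x : 'I_m.+1 := inord (f x).-1.
have hE x : x \in A -> (h x).+1 = f x.
  by move=> /fm rg; rewrite inordK; lia.
have hI : {in A &, injective h}.
  by move=> x y Ax Ay eqh; apply: fI; rewrite // -!hE // eqh.
have cardh := card_in_imset hI; split=> [|lem k rgk].
  by rewrite -cardh (leq_trans (max_card _)) ?card_ord.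
have : h @: A == setT by rewrite eqEcard subsetT cardsT card_ord cardh.
move/eqP/setP/(_ (inord k.-1)); rewrite inE => /imsetP[x Ax eqk].
by exists x; rewrite // -hE // -eqk inordK; lia.
Qed.

Section LaminarRelation.

Variables (T : finType) (e : rel T).
Hypotheses (e_sym : symmetric e) (e_irr : irreflexive e).
Hypothesis twin_free : forall u v x, e u x -> e u =1 e v -> u = v.

Let N u := [set y | e u y].

Hypothesis nested : forall u v,
  [\/ N u \subset N v, N v \subset N u | [disjoint N u & N v]].

Let inN u y : (y \in N u) = e u y. Proof. by rewrite inE. Qed.

Lemma nested_common u v x : e u x -> e v x ->
  N u \subset N v \/ N v \subset N u.
Proof.
move=> ux vx; case: (nested u v); [by left | by right |].
by move/(@disjointFr _ _ _ x); rewrite !inN ux vx => /(_ isT).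
Qed.

(** Nested sets of equal size coincide, so degrees tell apart vertices with a common neighbour. *)
Lemma nested_same_card u v x : e u x -> e v x -> #|N u| = #|N v| -> u = v.
Proof.
move=> ux vx eqc; suff /setP eqN : N u = N v.
  by apply: twin_free ux _ => y; rewrite -!inN eqN.
by apply/eqP; case: (nested_common ux vx) => suv; [|rewrite eq_sym];
  rewrite eqEcard suv eqc leqnn.
Qed.

(** N(x) and N(x') share [w], hence are nested, and the one of [x], [x'] with the larger
    neighbourhood is adjacent to both [u] and [u']. *)
Lemma nested_chain w u u' x x' : e w x -> e w x' -> e u x -> e u' x' ->
  exists2 z, e u z & e u' z.
Proof.
move=> wx wx' ux ux'.
have [||/subsetP s|/subsetP s] := @nested_common x x' w; rewrite 1?e_sym //.
  by exists x' => //; rewrite e_sym -inN s // inN e_sym.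
by exists x => //; rewrite e_sym -inN s // inN e_sym.
Qed.

(** Let [v] have largest degree in [S], and let [A] be the set of vertices whose neighbourhoods meet
    N(v). Then [A] and N(v) are the two sides of a component. On each side degrees are distinct,
    positive and at most the size of the other side, so the sizes agree and every degree occurs
    once; ordering by degree yields the half-graph. *)
Lemma half_graph_component (S : {set T}) v0 x0 :
    (forall u v, u \in S -> e u v -> v \in S) -> v0 \in S -> e v0 x0 ->
  exists n (g : co_half_graph n -> T),
   [/\ injective g,
       forall a b, compl_adj a b = e (g a) (g b),
       forall a y, e (g a) y -> exists b, y = g b &
       forall a, g a \in S].
Proof.
move=> clS Sv0 v0x0; have Pv0 : (v0 \in S) && (N v0 != set0).
  by rewrite Sv0; apply/set0Pn; exists x0; rewrite inN.
have [v /andP[Sv]] := @arg_maxnP _ v0 (fun u => (u \in S) && (N u != set0))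
  (fun u => #|N u|) Pv0.
case/set0Pn=> {v0 Sv0 v0x0 Pv0} x1; rewrite inN => vx1 maxv.
have [n cardB] : exists n, #|N v| = n.+1.
  exists #|N v|.-1; rewrite prednK // card_gt0.
  by apply/set0Pn; exists x1; rewrite inN.
pose A := [set u | N u :&: N v != set0].
have inA u : reflect (exists2 x, e u x & e v x) (u \in A).
  rewrite inE; apply: (iffP (set0Pn _)) => [[x]|[x ux vx]].
    by rewrite inE !inN => /andP[]; exists x.
  by exists x; rewrite inE !inN ux.
have subA u : u \in A -> N u \subset N v.
  case/inA=> x ux vx; case: (nested_common ux vx) => // svu.
  suff -> : N v = N u by [].
  apply/eqP; rewrite eqEcard svu; apply: maxv.
  apply/andP; split; last by apply/set0Pn; exists x; rewrite inN.
  by apply: (clS x); rewrite 1?(clS v) // e_sym.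
have dA : {in A, forall u, 0 < #|N u| <= n.+1}.
  move=> u Au; rewrite -cardB subset_leq_card ?subA // andbT card_gt0.
  by case/inA: Au => x ux _; apply/set0Pn; exists x; rewrite inN.
have dIA : {in A &, injective (fun u => #|N u|)}.
  move=> u u' /inA[x ux vx] /inA[x' ux' vx'].
  have [z uz u'z] := nested_chain vx vx' ux ux'.
  exact: nested_same_card uz u'z.
have subB x : x \in N v -> N x \subset A.
  rewrite inN => vx; apply/subsetP=> u; rewrite inN => xu; apply/inA.
  by exists x; rewrite // e_sym.
have dB : {in N v, forall x, 0 < #|N x| <= #|A|}.
  move=> x vx; rewrite subset_leq_card ?subB // andbT card_gt0.
  by apply/set0Pn; exists v; rewrite inN e_sym -inN.
have dIB : {in N v &, injective (fun u => #|N u|)}.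
  move=> x x'; rewrite !inN => vx vx'.
  by apply: (@nested_same_card x x' v); rewrite e_sym.
have [leAm surjA] := card_inj_range dIA dA.
have [lemA surjB] := card_inj_range dIB dB.
have cardA : #|A| = n.+1 by apply/eqP; rewrite eqn_leq leAm -cardB.
rewrite cardB in lemA surjB.
rewrite cardA in dB lemA surjA surjB; have {}surjA := surjA lemA.
have {}surjB := surjB (leqnn _).
(* A vertex on both sides would put [v] into N(u), which is inside N(v): a loop. *)
have AB u : u \in A -> u \in N v -> False.
  move=> Au vu; have sub := subA _ Au; rewrite inN in vu.
  have: v \in N v by rewrite (subsetP sub) // inN e_sym.
  by rewrite inN e_irr.
(* These are the degrees of a_i and b_j in a half-graph of order [n.+1] indexed from 0. *)
have exa (i : 'I_n.+1) : {u | (u \in A) && (#|N u| == n.+1 - i)}.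
  apply: sigW; have [|u Au du] := surjA (n.+1 - i); first by have :=
    ltn_ord i; lia.
  by exists u; rewrite Au du eqxx.
have exb (j : 'I_n.+1) : {x | (x \in N v) && (#|N x| == j.+1)}.
  apply: sigW; have [|x vx dx] := surjB j.+1; first by have := ltn_ord j; lia.
  by exists x; rewrite vx dx eqxx.
pose a i := sval (exa i); pose b j := sval (exb j).
have aA i : a i \in A by case/andP: (svalP (exa i)).
have da i : #|N (a i)| = n.+1 - i by case/andP: (svalP (exa i)) => _ /eqP.
have bB j : b j \in N v by case/andP: (svalP (exb j)).
have db j : #|N (b j)| = j.+1 by case/andP: (svalP (exb j)) => _ /eqP.
have aI : injective a.
  move=> i j /(congr1 (fun u => #|N u|)); rewrite !da => eqij; apply: ord_inj.
  by have := ltn_ord i; have := ltn_ord j; lia.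
have bI : injective b.
  move=> i j /(congr1 (fun u => #|N u|)); rewrite !db => -[]; exact: ord_inj.
have a_surj u : u \in A -> exists i, u = a i.
  move=> Au; have rg := dA _ Au.
  have lt : n.+1 - #|N u| < n.+1 by lia.
  exists (Ordinal lt); apply: dIA; rewrite ?aA // da /=; lia.
have b_surj x : x \in N v -> exists j, x = b j.
  move=> Bx; have rg := dB _ Bx.
  have lt : #|N x|.-1 < n.+1 by lia.
  exists (Ordinal lt); apply: dIB; rewrite ?bB // db /=; lia.
(* N(a_i) shrinks as i grows, so the indices of the neighbours of b_j form an initial segment, of
   size [j.+1]. *)
have eab i j : e (a i) (b j) = (i <= j).
  have aD : a @: (a @^-1: N (b j)) = N (b j).
    apply/setP=> u; apply/imsetP/idP => [[k]|bu]; first by rewrite inE => ? ->.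
    have [k defu] := a_surj _ (subsetP (subB _ (bB j)) u bu).
    by exists k; rewrite // inE -defu.
  have downD (i' k : 'I_n.+1) : i' <= k ->
      k \in a @^-1: N (b j) -> i' \in a @^-1: N (b j).
    rewrite !inE !(e_sym (b j)) => lei'k akb.
    have [x aix vx] := inA _ (aA i'); have [y aky vy] := inA _ (aA k).
    have [z aiz akz] := nested_chain vx vy aix aky.
    have [sik|ski] := nested_common aiz akz;
      last by rewrite -inN (subsetP ski) // inN.
    suff -> : a i' = a k by [].
    apply: (nested_same_card aiz akz); apply/eqP.
    by rewrite eqn_leq subset_leq_card // !da leq_sub2l.
  have := down_closed_ord downD i.
  by rewrite -(card_imset _ aI) aD db ltnS inE inN e_sym.
have eaa u u' : u \in A -> u' \in A -> e u u' = false.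
  move=> Au Au'; apply/negP=> uu'; apply: (AB u') => //.
  by rewrite (subsetP (subA _ Au)) // inN.
have ebb x x' : x \in N v -> x' \in N v -> e x x' = false.
  move=> vx vx'; apply/negP=> xx'; apply: (AB x') => //; apply/inA.
  by exists x; rewrite -?inN // inN e_sym.
pose g (c : co_half_graph n) := match c with inl i => a i | inr j => b j end.
exists n, g; split.
- case=> i [] j /=.
  + by move/aI->.
  + by move=> eqab; case: (AB (b j)); rewrite // -eqab.
  + by move=> eqab; case: (AB (b i)); rewrite // eqab.
  + by move/bI->.
- case=> i [] j; rewrite compl_co_half_adj /=.
  + by rewrite eaa.
  + by rewrite eab.
  + by rewrite e_sym eab.
  + by rewrite ebb.
- case=> i y /= ey.
    have [|j ->] := b_surj y; last by exists (inr j).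
    by rewrite (subsetP (subA _ (aA i))) // inN.
  have [|j ->] := a_surj y; last by exists (inl j).
  by rewrite (subsetP (subB _ (bB i))) // inN.
- have clB j : b j \in S by apply: (clS v) => //; rewrite -inN.
  case=> i //=; have [x ax vx] := inA _ (aA i).
  by apply: (clS x); rewrite 1?(clS v) // e_sym.
Qed.


(** Induction on the size of [S]: while some vertex of [S] has a neighbour, split off a half-graph
    component; the isolated vertices left over form [K]. The isolated vertex assumed in [S] survives
    every removal, so [K] is nonempty. *)
Lemma co_half_decomposition (S : {set T}) :
    (forall u v, u \in S -> e u v -> v \in S) ->
    (exists2 z, z \in S & isolated e z) ->
  exists (ns : seq nat) (K : graph)
    (g : foldr full_union K (map co_half_graph ns) -> T),
    [/\ complete K, injective g, forall x, x \in S <-> exists a, x = g a &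
        forall a b, adj a b = (a != b) && ~~ e (g a) (g b)].
Proof.
have [n] := ubnP #|S|; elim: n S => // n IHn S; rewrite ltnS => leSn clS isoS.
have [/existsP[v /andP[Sv /forallPn[y0]]]|/existsPn allI] :=
  boolP [exists v, (v \in S) && ~~ [forall y, ~~ e v y]]; last first.
  have [z Sz _] := isoS.
  pose K := @Graph {x | x \in S} (fun u v => u != v)
    (fun u v => congr1 negb (eq_sym u v))
    (introT card_gt0P (ex_intro _ (exist _ z Sz) isT)).
  exists [::], K, val; split=> //; first exact: val_inj.
    by move=> x; split=> [Sx|[[y Sy] ->] //]; exists (exist _ x Sx).
  move=> [a Sa] b; have := allI a;
    rewrite Sa negbK => /forallP/(_ (val b)) /= ->.
  by rewrite andbT.
rewrite negbK => vy0; have [m [g [gI gE gcl gS]]] :=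
  half_graph_component clS Sv vy0.
have gnz a : exists y, e (g a) y.
  case: a => i; [exists (g (inr i)) | exists (g (inl i))];
    by rewrite -gE compl_co_half_adj.
pose S' := S :\: [set g a | a in setT].
have inS' x : (x \in S') = (x \notin codom g) && (x \in S).
  rewrite !inE; congr (~~ _ && _); apply/imsetP/codomP.
    by case=> a _ ->; exists a.
  by case=> a ->; exists a.
have ltS' : #|S'| < n.
  apply: leq_trans leSn; apply: proper_card; apply/properP; split.
    exact: subsetDl.
  by exists (g (inl ord0)); rewrite // inS' codom_f.
have clS' u w : u \in S' -> e u w -> w \in S'.
  rewrite !inS' => /andP[gu Su] uw; rewrite (clS u) // andbT.
  apply: contraNN gu => /codomP[a defw]; apply/codomP; apply: (gcl a).
  by rewrite -defw e_sym.
have isoS' : exists2 z, z \in S' & isolated e z.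
  have [z Sz isoz] := isoS; exists z => //; rewrite inS' Sz andbT.
  apply/negP=> /codomP[a defz]; have [y] := gnz a.
  by rewrite -defz (negPf (isoz y)).
have [ns [K [h [cK hI hS hE]]]] := IHn S' ltS' clS' isoS'.
have hS' a : h a \in S' by apply/hS; exists a.
have ghneq a b : g a <> h b.
  by move=> eqgh; have := hS' b; rewrite inS' -eqgh codom_f.
have ghnadj a b : e (g a) (h b) = false.
  by apply/negP=> /gcl[a' eqh]; apply: (ghneq a' b).
have adjg a b : adj a b = (a != b) && ~~ e (g a) (g b).
  rewrite -gE /compl_adj; have [->|_] := eqVneq a b; last by rewrite negbK.
  by case: (b) => i; rewrite /= eqxx.
pose f (c : full_union (co_half_graph m) (foldr full_union K (map co_half_graph
  ns))) :=
  match c with inl a => g a | inr b => h b end.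
exists (m :: ns), K, f; split=> //.
- case=> a [] b //=; first by move/gI->.
  + by move/ghneq.
  + by move/esym/ghneq.
  + by move/hI->.
- move=> x; split=> [Sx|[[a|b] ->]] //=; last by have := hS' b;
  rewrite inS' => /andP[].
  have [/codomP[a ->]|gx] := boolP (x \in codom g); first by exists (inl a).
  have /hS[b ->] : x \in S' by rewrite inS' gx.
  by exists (inr b).
- case=> a [] b /=.
  + exact: adjg.
  + by rewrite ghnadj.
  + by rewrite e_sym ghnadj.
  + exact: hE.
Qed.

End LaminarRelation.

(** * Well-graded neighbourhood systems *)

Lemma mem_nbhd (H : graph) (u v : H) : (v \in nbhd u) = adj u v.
Proof. by rewrite inE. Qed.

Lemma nbhd_in_family (H : graph) (u : H) : nbhd u \in nbhd_family H.
Proof. exact: imset_f. Qed.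

(** The isolated vertex supplies the empty set, which is also what remains after peeling a
    singleton. *)
Lemma peelable_tree_like (H : graph) :
  peelable (@adj H) -> (exists z, isolated (@adj H) z) ->
  tree_like (nbhd_family H).
Proof.
move=> pH [z isoz].
have F0 : set0 \in nbhd_family H.
  apply/imsetP; exists z => //; apply/setP=> y.
  by rewrite mem_nbhd inE (negPf (isoz y)).
split=> // _ /imsetP[u _ ->] /set0Pn[y]; rewrite mem_nbhd.
case/pH=> x [ux minx peelx]; exists x; split.
- by rewrite mem_nbhd.
- case: peelx => [defu|[u' defu']].
    suff -> : nbhd u :\ x = set0 by [].
    by apply/setP=> w; rewrite !inE defu andNb.
  suff -> : nbhd u :\ x = nbhd u' by apply: nbhd_in_family.
  by apply/setP=> w; rewrite !inE defu' andbC.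
move=> _ /imsetP[v _ ->]; rewrite mem_nbhd => vx.
by apply/subsetP=> w; rewrite !mem_nbhd; apply: minx.
Qed.

Section WellGradedNeighbourhoods.

Variable H : graph.
Hypothesis H_loopless : loopless H.
Hypothesis H_step : step (nbhd_family H).

Implicit Types u v w x y b : H.

Local Notation F := (nbhd_family H).

(* If N(w) = N(v) + b, then b is the only vertex distinguishing v from w, so a
   neighbour of N(b) in the one-inclusion graph is N(b) + v or N(b) - w. *)
Lemma nbhd_label b y : adj b y -> exists v w,
  [/\ adj b w, ~~ adj b v & forall x, x != b -> adj x v = adj x w].
Proof.
rewrite adj_sym => yb.
(* N(y) contains [b] and, without loops, N(b) does not, so some edge is labelled [b]. *)
have [||C FC /andP[bC FbC]] :=
    @step_label _ F (nbhd y) (nbhd b) b H_step (nbhd_in_family _)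
      (nbhd_in_family _); rewrite ?mem_nbhd ?H_loopless //.
case/imsetP: FC bC FbC => v _ -> bv /imsetP[w _ defw].
have inw x : adj w x = (adj v x != (x == b)).
  by rewrite -mem_nbhd -defw in_flip mem_nbhd.
rewrite mem_nbhd in bv; exists v, w; split.
- by rewrite adj_sym inw eqxx (negPf bv).
- by rewrite adj_sym.
move=> x neqxb; rewrite !(adj_sym x) inw (negPf neqxb).
by case: (adj v x).
Qed.

(** Some pair of vertices is separated by N(u) alone; a twin of [u] would separate it too. *)
Lemma nbhd_twin_free u v x : adj u x -> adj u =1 adj v -> u = v.
Proof.
case/nbhd_label=> p [q [uq up sep]] eqN; apply/eqP; apply: contraT.
by rewrite eq_sym => /sep; rewrite -!eqN uq (negPf up).
Qed.

Lemma nbhd_flip b y : adj b y -> exists v w,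
  [/\ adj b w, ~~ adj b v & forall x, flip x (nbhd b) \in F -> x = v \/ x = w].
Proof.
move=> /nbhd_label[v [w [bw bv sep]]]; exists v, w; split=> // x.
have [->|neqv] := eqVneq x v; first by left.
have [->|neqw] := eqVneq x w; first by right.
case/imsetP=> c _ /setP defc.
have inc z : adj c z = (adj b z != (z == x)).
  by rewrite -mem_nbhd -defc in_flip mem_nbhd.
have /sep : c != b.
  by apply/eqP=> eqcb; have := inc x; rewrite eqcb eqxx; case: (adj b x).
by rewrite !inc bw (negPf bv) !(eq_sym _ x) (negPf neqv) (negPf neqw).
Qed.

(** Of the two possible flips of N(u), one adds [v] and the other removes [w]: there is at most one
    neighbour above and, in the next lemma, at most one below. *)
Lemma nbhd_upper u y a b : adj u y -> ~~ adj u a -> ~~ adj u b ->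
  flip a (nbhd u) \in F -> flip b (nbhd u) \in F -> a = b.
Proof.
case/nbhd_flip=> v [w [uw uv sep]] ua ub.
by case/sep=> eqa; case/sep=> eqb; rewrite ?eqa ?eqb //;
  move: ua ub; rewrite ?eqa ?eqb uw.
Qed.

Lemma nbhd_lower u y a b : adj u y -> adj u a -> adj u b ->
  flip a (nbhd u) \in F -> flip b (nbhd u) \in F -> a = b.
Proof.
case/nbhd_flip=> v [w [uw uv sep]] ua ub.
by case/sep=> eqa; case/sep=> eqb; rewrite ?eqa ?eqb //;
  move: ua ub; rewrite ?eqa ?eqb (negPf uv).
Qed.

(* Otherwise let N(b) be minimal in the family. Its only neighbour is some
   N(b) + v, so v lies in every other member; as v is not in N(v), this gives
   N(v) = N(b), hence v = b. Then b is joined to all other vertices and, N(b)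
   being minimal, so is every vertex, while N(b) + b is a neighbourhood. *)
Lemma nbhd_isolated : exists z, isolated (@adj H) z.
Proof.
have /card_gt0P[z0 _] := vertex_gt0 H.
have [b _ minb] := @arg_minnP _ z0 predT (fun u => #|nbhd u|) isT.
have [/forallP iso_b|/forallPn[y]] := boolP [forall y, ~~ adj b y].
  by exists b.
rewrite negbK => bby; have [v [w [bw bv sepb]]] := nbhd_flip bby.
have down x : adj b x -> flip x (nbhd b) \in F -> False.
  move=> bx /imsetP[c _ defc]; have := minb c isT.
  by rewrite -defc flipD1 ?mem_nbhd // (cardsD1 x (nbhd b)) mem_nbhd bx ltnn.
have up c : c != b -> adj c v /\ flip v (nbhd b) \in F.
  move=> neqcb; have neqN : nbhd b != nbhd c.
    apply: contraNneq neqcb => /setP eqN; rewrite eq_sym; apply/eqP.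
    by apply: nbhd_twin_free bby _ => x; rewrite -!mem_nbhd eqN.
  have [x bcx Fx] := H_step (nbhd_in_family b) (nbhd_in_family c) neqN.
  case: (sepb x Fx) => defx; last by case: (down w) => //; rewrite -defx.
  by move: bcx Fx; rewrite defx !mem_nbhd (negPf bv); case: (adj c v).
have defv : v = b.
  by apply/eqP; apply: contraT => /up[]; rewrite H_loopless.
have neqyb : y != b by apply: contraTneq bby => ->; rewrite H_loopless.
have [_ /imsetP[c _ /setP defc]] := up y neqyb.
have inc z : adj c z = (adj b z != (z == b)).
  by rewrite -mem_nbhd -defc in_flip mem_nbhd defv.
have neqcb : c != b.
  by apply/eqP=> eqcb; have := inc b; rewrite eqcb H_loopless eqxx.
have bc : adj b c by have [+ _] := up c neqcb; rewrite defv adj_sym.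
by have := inc c; rewrite H_loopless bc (negPf neqcb).
Qed.

(** Suppose N(u) and N(v) meet but are not nested, and step from N(u) to some N(c) towards N(v). By
    induction N(c) and N(v) are nested, and the next step towards N(v) goes in the direction
    opposite to the first. Then N(c) has two neighbours on the same side, one of them N(u), which is
    impossible. *)
Lemma nbhd_nested u v :
  [\/ nbhd u \subset nbhd v, nbhd v \subset nbhd u | [disjoint nbhd u & nbhd
    v]].
Proof.
have [dis|] := boolP [disjoint nbhd u & nbhd v]; first by constructor 3.
rewrite -setI_eq0 => ndis; suff /orP[] :
  (nbhd u \subset nbhd v) || (nbhd v \subset nbhd u).
- by constructor 1.
- by constructor 2.
have [n] := ubnP #|nbhd u :\: nbhd v :|: nbhd v :\: nbhd u|.
elim: n u ndis => // n IHn u /set0Pn[z]; rewrite inE !mem_nbhd => /andP[uz vz].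
rewrite ltnS => leD; apply: contraT; rewrite negb_or => /andP[nuv nvu].
have neqN : nbhd u != nbhd v by apply: contraNneq nuv => ->.
have [x xuv /[dup] Fx /imsetP[c _ defc]] :=
  H_step (nbhd_in_family u) (nbhd_in_family v) neqN.
have neqxz : z != x.
  by apply: contraTneq xuv => <-; rewrite !mem_nbhd uz vz.
have cz : adj c z.
  by rewrite -mem_nbhd -defc in_flip mem_nbhd uz (negPf neqxz).
have inc y : adj c y = (adj u y != (y == x)).
  by rewrite -mem_nbhd -defc in_flip mem_nbhd.
have step_from : nbhd c != nbhd v ->
  exists2 y, adj c y != adj v y & flip y (nbhd c) \in F.
  move=> neq; have [y] := H_step (nbhd_in_family c) (nbhd_in_family v) neq.
  by rewrite !mem_nbhd; exists y.
have Fcx : flip x (nbhd c) \in F.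
  by rewrite -defc -(flip_inv (erefl _)) nbhd_in_family.
rewrite !mem_nbhd in xuv.
have /orP[scv|svc] : (nbhd c \subset nbhd v) || (nbhd v \subset nbhd c).
- apply: IHn; first by apply/set0Pn; exists z; rewrite inE !mem_nbhd cz.
  apply: leq_trans leD; apply: proper_card; apply/properP; split.
    apply/subsetP=> y; rewrite !inE inc; have [->|_] := eqVneq y x.
      by move: xuv; case: (adj u x); case: (adj v x).
    by case: (adj u y); case: (adj v y).
  by exists x; move: xuv; rewrite !inE ?inc ?eqxx; case: (adj u x); case:
    (adj v x).
(* Here [x] was removed, as otherwise N(u) would be inside N(v); the next step adds some [y], so
   N(c) has two upper neighbours. *)
- have ux : adj u x && ~~ adj v x.
    apply: contraR nuv => nux; apply/subsetP=> y; rewrite !mem_nbhd => uy.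
    have [eqyx|neqyx] := eqVneq y x; first by move: nux; rewrite -eqyx uy negbK.
    by rewrite -mem_nbhd (subsetP scv) // mem_nbhd inc uy (negPf neqyx).
  case/andP: ux => ux vx.
  have [|y cvy Fy] := step_from.
    apply: contraNneq nvu => /setP eqcv; apply/subsetP=> y.
    rewrite -eqcv !mem_nbhd inc; have [->|_] := eqVneq y x; first by rewrite ux.
    by case: (adj u y).
  have ncy : ~~ adj c y.
    apply: contraNN cvy => cy; rewrite cy; apply/eqP/esym.
    by rewrite -mem_nbhd (subsetP scv) // mem_nbhd.
  have eqxy : x = y by apply: nbhd_upper cz _ ncy Fcx Fy; rewrite inc ux eqxx.
  by move: cvy ncy; rewrite -eqxy (negPf vx); case: (adj c x).
(* Dually, [x] was added and the next step removes [y], giving two lower neighbours of N(c). *)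
have ux : ~~ adj u x && adj v x.
  apply: contraR nvu => nux; apply/subsetP=> y vy.
  have := subsetP svc y vy; rewrite !mem_nbhd inc in vy *.
  have [eqyx|_] := eqVneq y x; last by case: (adj u y).
  by move: xuv nux; rewrite -eqyx vy; case: (adj u y).
case/andP: ux => ux vx.
have [|y cvy Fy] := step_from.
  apply: contraNneq nuv => /setP eqcv; apply/subsetP=> y.
  rewrite -eqcv !mem_nbhd inc; have [->|_] := eqVneq y x;
    first by rewrite (negPf ux).
  by case: (adj u y).
have cy : adj c y.
  apply: contraNT cvy => ncy; rewrite (negPf ncy) eq_sym; apply/eqP/negbTE.
  by apply: contraNN ncy => vy; rewrite -mem_nbhd (subsetP svc) // mem_nbhd.
have eqxy : x = y by apply: nbhd_lower cz _ cy Fcx Fy;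
  rewrite inc (negPf ux) eqxx.
by move: cvy; rewrite -eqxy vx inc (negPf ux) eqxx.
Qed.

End WellGradedNeighbourhoods.

(** * Passing between a graph and its complement *)

Lemma compl_loopless (G : graph) : loopless (compl G).
Proof. by move=> x; rewrite /= /compl_adj eqxx. Qed.

Lemma nbhd_family_compl (G : graph) : loopless G ->
  nbhd_family (compl G) = compl_family (cl_nbhd_family G).
Proof.
move=> loopG; rewrite /compl_family /cl_nbhd_family -imset_comp.
apply: eq_imset => v; apply/setP=> y.
by rewrite !inE /= /compl_adj negb_or eq_sym.
Qed.

Lemma co_half_union_decomposition (G : graph) : loopless G ->
    step (nbhd_family (compl G)) ->
  exists (ns : seq nat) (K : graph),
    complete K /\ isomorphic G (foldr full_union K (map co_half_graph ns)).
Proof.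
move=> loopG stG; have loopH := @compl_loopless G.
have twin := @nbhd_twin_free (compl G) loopH stG.
have nest := @nbhd_nested (compl G) loopH stG.
have [z isoz] := @nbhd_isolated (compl G) loopH stG.
have [||ns [K [g [cK gI gS gE]]]] :=
  @co_half_decomposition G _ (@compl_adj_sym G) loopH twin nest setT.
- by move=> u v _ _; rewrite inE.
- by exists z.
exists ns, K; split=> //.
have g_surj x : exists a, g a == x.
  have /gS[a ->] : x \in setT by rewrite inE.
  by exists a.
pose f x := xchoose (g_surj x).
have fK : cancel f g by move=> x; apply/eqP/(xchooseP (g_surj x)).
have gK : cancel g f by move=> a; apply: gI; rewrite fK.
exists f; first by exists g.
move=> u v; rewrite gE !fK (inj_eq (can_inj fK)) /compl_adj.
have [->|_] := eqVneq u v; last by rewrite negbK.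
by rewrite loopG.
Qed.

(** There are at most as many closed neighbourhoods as vertices, so only one; it contains every
    vertex, since each lies in its own. *)
Lemma maximum_complete (G : graph) : loopless G -> maximum (cl_nbhd_family G) ->
  complete G.
Proof.
move=> loopG maxG; have := small_maximum maxG (leq_imset_card _ _).
move=> /eqP/cards1P[A defF] u v.
have inA w : w \in A.
  have : cl_nbhd w \in cl_nbhd_family G by apply: imset_f.
  by rewrite defF inE => /eqP <-; rewrite setU11.
have : cl_nbhd u \in cl_nbhd_family G by apply: imset_f.
rewrite defF inE => /eqP/setP/(_ v); rewrite inA !inE [u == v]eq_sym.
by have [->|_] := eqVneq v u; rewrite ?loopG.
Qed.

Theorem theorem5p12 (G : graph) (G_loopless : loopless G) :
  [<-> well_graded (cl_nbhd_family G);
       extremal (cl_nbhd_family G);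
       complete G \/
         (exists (ns : seq nat) (K : graph),
            [/\ ns != [::], complete K &
                isomorphic G (foldr full_union K (map co_half_graph ns))]);
       well_graded (nbhd_family (compl G))] /\
  [<-> maximum (cl_nbhd_family G);
       maximum (nbhd_family (compl G));
       complete G].
Proof.
have famE := nbhd_family_compl G_loopless.
have famE' : cl_nbhd_family G = compl_family (nbhd_family (compl G)).
  by rewrite famE compl_familyK.
have step_struct : step (nbhd_family (compl G)) -> complete G \/
    (exists (ns : seq nat) (K : graph), [/\ ns != [::], complete K &
       isomorphic G (foldr full_union K (map co_half_graph ns))]).
  (* With no co-half-graph in the list, [G] is isomorphic to [K] and hence complete. *)
  case/(co_half_union_decomposition G_loopless)=> -[|n ns] [K [cK isoG]].
    left; case: isoG => f [g fK _] fM u v.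
    by rewrite -fM /= cK (inj_eq (can_inj fK)).
  by right; exists (n :: ns), K.
have struct_tree : complete G \/
    (exists (ns : seq nat) (K : graph), [/\ ns != [::], complete K &
       isomorphic G (foldr full_union K (map co_half_graph ns))]) ->
    tree_like (nbhd_family (compl G)).
  case=> [cG|[ns [K [_ cK isoG]]]].
    apply: peelable_tree_like; first exact: (@complete_peelable G).
    have /card_gt0P[z _] := vertex_gt0 G.
    by exists z; apply: (@complete_isolated G).
  have [pG iG] := full_unions_peelable ns cK.
  by have [] := peelable_iso isoG pG iG; apply: (@peelable_tree_like (compl G)).
split; tfae.
(* Well-graded to extremal goes through the structure of [G] and the tree-like family of the
   complement. *)
- move/well_graded_step/step_compl; rewrite -famE => /step_struct/struct_tree.
  by rewrite famE' => /tree_like_extremal/extremal_compl.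
- by move/extremal_step/step_compl; rewrite -famE.
- by move/struct_tree/tree_like_step/well_graded_step.
- by rewrite famE' => /well_graded_step/step_compl/well_graded_step.
- by rewrite famE; apply: maximum_compl.
- move/maximum_compl; rewrite -famE' => maxG.
  exact: (@maximum_complete G G_loopless maxG).
move=> cG; suff -> : cl_nbhd_family G = [set setT] by apply: maximum_card1.
have /card_gt0P[z _] := vertex_gt0 G.
have NT (v : G) : cl_nbhd v = setT.
  by apply/setP=> y; rewrite in_setU1 mem_nbhd cG eq_sym orbN inE.
apply/setP=> A; rewrite inE; apply/imsetP/eqP=> [[v _ ->] //|->].
by exists z; rewrite ?NT.
Qed.
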